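(* Let $G=(V,E)$ be a self-centered Bonnet-Myers sharp graph. Then for any two different vertices $x,y\in V$, the induced subgraph of the interval $[x,y]$ is antipodal. Therefore $G$ is strongly spherical.
   Context: All graphs are finite, simple, undirected, unweighted, connected, and have at least one edge. $d$ denotes the combinatorial distance and $\mathrm{diam}(G)=\max_{x,y}d(x,y)$; $x\sim y$ means that $x,y$ are adjacent. A graph $G$ is self-centered if for every vertex $x$ there is a vertex $\overline x$ with $d(x,\overline x)=\mathrm{diam}(G)$. For a $D$-regular graph $G=(V,E)$ and $x\in V$, let $\mu_x$ be the probability measure on $V$ giving mass $\frac1{D+1}$ to $x$ and to each of its $D$ neighbours. The Wasserstein distance of probability measures $\mu,\nu$ on $V$ is $W_1(\mu,\nu)=\inf_\pi\sum_{u,v\in V}d(u,v)\pi(u,v)$, where $\pi:V\times V\to[0,1]$ runs over all couplings with marginals $\mu$ and $\nu$. The (modified) Ollivier Ricci curvature of two different vertices $x,y$ is $$\kappa(x,y)=\frac{D+1}{D}\left(1-\frac{W_1(\mu_x,\mu_y)}{d(x,y)}\right).$$ A $D$-regular graph $G$ of diameter $L$ is called Bonnet-Myers sharp if $\inf_{x\sim y}\kappa(x,y)=\frac2L$. The interval between $x,y\in V$ is $[x,y]=\{z\in V:d(x,z)+d(z,y)=d(x,y)\}$. A graph $H$ is antipodal if for every vertex $x$ of $H$ there is another vertex $\overline x$ of $H$ such that the interval $[x,\overline x]$ of $H$ is the whole vertex set of $H$. A graph $G=(V,E)$ is strongly spherical if $G$ and the induced subgraphs of all its intervals $[x,y]$,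 $x\neq y$, are antipodal; equivalently: for every $x\in V$ there is $\overline x\in V$ with $[x,\overline x]=V$, and for every pair $x\ne y$ in $V$ and every $z\in[x,y]$ there is $\overline z\in[x,y]$ with $[x,y]=[z,\overline z]$. *)

(* Defs.v *)
From HB Require Import structures.
From mathcomp Require Import all_boot all_order all_algebra.
From mathcomp Require Import classical_sets reals.

Set Implicit Arguments.
Unset Strict Implicit.
Unset Printing Implicit Defensive.

Import Order.TTheory GRing.Theory Num.Theory.
Local Open Scope ring_scope.

Section Graph.
Variables (V : finType) (e : rel V).

Definition is_graph : Prop :=
  [/\ symmetric e, irreflexive e, (forall x y, connect e x y)
    & exists x y, e x y].

Definition walk (n : nat) (x y : V) : bool :=
  [exists p : n.-tuple V, path e x p && (last x p == y)].

(* Length of a shortest walk from x to y. Shortest walks have fewer than #|V|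
   edges, and #|V| is the junk value when y is not reachable from x. *)
Definition gdist (x y : V) : nat := find (fun n => walk n x y) (iota 0 #|V|).

Definition diam : nat := \max_(x : V) \max_(y : V) gdist x y.

Definition self_centered : Prop := forall x, exists y, gdist x y = diam.

Definition regular (D : nat) : Prop := forall x, #|[set y | e x y]| = D.

Definition ginterval (x y : V) : {set V} :=
  [set z | gdist x z + gdist z y == gdist x y]%N.

Definition antipodal : Prop :=
  forall x, exists2 y, y != x & ginterval x y = [set: V].

Definition induced (A : {set V}) : rel {x : V | x \in A} :=
  [rel u v | e (val u) (val v)].

End Graph.

Definition strongly_spherical (V : finType) (e : rel V) : Prop :=
  antipodal e /\
  forall x y, x != y -> antipodal (induced e (A := ginterval e x y)).

Section Curvature.
Variables (R : realType) (V : finType) (e : rel V).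

(* Measures on V are given by their mass functions V -> R. *)
Definition coupling (mu nu : V -> R) (pi : V -> V -> R) : Prop :=
  [/\ forall u v, 0 <= pi u v <= 1,
      forall u, \sum_v pi u v = mu u
    & forall v, \sum_u pi u v = nu v].

Definition W1 (mu nu : V -> R) : R :=
  inf [set \sum_u \sum_v (gdist e u v)%:R * pi u v
      | pi in [set pi | coupling mu nu pi]]%classic.

Definition ball_measure (D : nat) (x : V) : V -> R :=
  fun u => if (u == x) || e x u then D.+1%:R^-1 else 0.

Definition kappa (D : nat) (x y : V) : R :=
  D.+1%:R / D%:R *
  (1 - W1 (ball_measure D x) (ball_measure D y) / (gdist e x y)%:R).

Definition Bonnet_Myers_sharp : Prop :=
  exists2 D : nat, regular e D &
    inf [set k | exists x y, e x y /\ k = kappa D x y]%classic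
    = 2 / (diam e)%:R.

End Curvature.

Lemma walkP (V : finType) (e : rel V) n x y :
  reflect (exists p, [/\ path e x p, last x p = y & size p = n])
          (walk e n x y).
Proof.
apply: (iffP existsP) => [[p /andP[ep /eqP lp]]|[p [ep lp sp]]].
  by exists p; rewrite size_tuple.
by exists (tcast sp (in_tuple p)); rewrite val_tcast /= ep lp eqxx.
Qed.

Lemma gdist_le (V : finType) (e : rel V) x p :
  path e x p -> (gdist e x (last x p) <= size p)%N.
Proof.
move=> ep; case: (ltnP (size p) #|V|) => [sp|sp]; last first.
  by rewrite (leq_trans (find_size _ _)) ?size_iota.
rewrite leqNgt; apply/negP => lt.
have w : walk e (size p) x (last x p) by apply/walkP; exists p.
by have := before_find 0%N lt; rewrite nth_iota // add0n w.
Qed.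

Lemma gdist_geodesic (V : finType) (e : rel V) x y :
  connect e x y ->
  exists p, [/\ path e x p, last x p = y & size p = gdist e x y].
Proof.
case/connectP => p0 ep0 ->; case/shortenP: ep0 => p ep up _.
have hasp : has (fun n => walk e n x (last x p)) (iota 0 #|V|).
  apply/hasP; exists (size p); last by apply/walkP; exists p.
  by rewrite mem_iota add0n; have /card_uniqP /= <- := up; exact: max_card.
have := nth_find 0%N hasp; rewrite nth_iota ?add0n; last first.
  by rewrite -[X in (_ < X)%N](size_iota 0) -has_find.
by move=> /= /walkP.
Qed.

(* Antipodality of an interval's induced subgraph never involves the junk value
   of gdist: these subgraphs are connected. *)
Lemma induced_interval_graph (V : finType) (e : rel V) x y :
  is_graph e -> x != y -> is_graph (induced e (A := ginterval e x y)).
Proof.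
case=> sym irr con _ xy.
have tri a b c : (gdist e a c <= gdist e a b + gdist e b c)%N.
  have [p [ep lp <-]] := gdist_geodesic (con a b).
  have [q [eq lq <-]] := gdist_geodesic (con b c).
  rewrite -size_cat -lq -[b]lp -last_cat; apply: gdist_le.
  by rewrite cat_path ep lp eq.
have d0 a : gdist e a a = 0%N by apply/eqP; rewrite -leqn0 (@gdist_le _ e a [::]).
have xI : x \in ginterval e x y by rewrite inE d0.
pose H := induced e (A := ginterval e x y).
have symH : symmetric H by move=> u v; apply: sym.
have cx z (zI : z \in ginterval e x y) : connect H (exist _ x xI) (exist _ z zI).
  have [p [ep lp sp]] := gdist_geodesic (con x z).
  have [n ltn] := ubnP (size p).
  elim: n => // n IH in z zI p ep lp sp ltn *.
  case/lastP: p => [|p w] in ep lp sp ltn *.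
    by rewrite /= in lp; subst z; rewrite (bool_irrelevance zI xI) connect0.
  move: ep; rewrite rcons_path last_rcons in lp *; subst w => /andP[ep ez].
  rewrite size_rcons in sp ltn.
  have lep := gdist_le ep.
  have ewz : (gdist e (last x p) z <= 1)%N.
    by apply: (@gdist_le _ e (last x p) [:: z]); rewrite /= ez.
  have t1 := tri x (last x p) z; have t2 := tri (last x p) z y.
  have t3 := tri x (last x p) y.
  have lpd : size p = gdist e x (last x p).
    apply/eqP; rewrite eqn_leq lep andbT -ltnS sp.
    by rewrite (leq_trans t1) // -addn1 leq_add2l.
  have wI : last x p \in ginterval e x y.
    rewrite inE eqn_leq t3 andbT; move: zI; rewrite inE => /eqP <-.
    rewrite -sp -lpd addSnnS leq_add2l.
    by rewrite (leq_trans t2) // -add1n leq_add2r.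
  apply: connect_trans (IH _ wI p ep erefl lpd ltn) _.
  exact: connect1.
split=> //; first by move=> u; apply: irr.
  move=> [u uI] [v vI]; apply: connect_trans (cx v vI).
  by rewrite (sym_connect_sym symH) cx.
have yI : y \in ginterval e x y by rewrite inE d0 addn0.
case/connectP: (cx y yI) => [[|w p] /=].
  by move=> _ /(congr1 val)/= /esym/eqP; rewrite (negPf xy).
by case/andP=> hw _ _; exists (exist _ x xI), w.
Qed.

(* Main.v *)
Require Import Defs.
From mathcomp Require Import all_boot all_order all_algebra reals.
From mathcomp Require Import classical_sets zify ring lra.

(** Write [L] for the diameter, [d] for the distance and [F_u(x)] for the sum of
    [d u] over the closed ball of radius 1 around [x]; put
    [c = D + 1 - 2 D / L].

    Sharpness says that the unnormalized transport cost between the balls of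
    two adjacent vertices is at most [c], so by duality [F_u] grows by at most
    [c] along an edge. If [d x y = L], then [F_x] and [F_y] bound the ball sums
    of [g = d x + d y] in such a way that [g] is superharmonic wherever it takes
    its minimal value [L]; hence [g] is constant ([diametral_interval]) and the
    interval [x, y] is all of [V]. As [F_u] must grow by [L c] on the way from
    [u] to its antipode, and every edge leading away from [u] lies on such a
    geodesic, [F_u] grows by exactly [c] along it ([dist_sum_edge]).

    Thus all functions [d u] (up to sign) are optimal Kantorovich potentials
    for the transport along an edge [p q] on which [d u] changes, and
    complementary slackness sends each neighbour [w] of [p] outside the ball of
    [q] to a common neighbour [v] of [w] and [q] such that [d u] changes along
    [w v] as it does along [p q] ([edge_matching]). Applying this to [u = v]
    shows that the target is forced: in every induced 4-cycle opposite edges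
    correspond to each other, and reading the 4-cycle from both of these edges
    gives [d u p + d u v = d u q + d u w] for all [u] ([four_cycle_balance]).

    Finally, such 4-cycles are glued together along a geodesic. If [z] lies in
    the interval [x, y], this produces a vertex [t] with
    [d z u + d t u = d x u + d y u] for all [u] ([parallel_pair]). This identity
    says at once that the intervals [x, y] and [z, t] coincide, so [t] is the
    antipode of [z] in [x, y]. *)

Set Implicit Arguments.
Unset Strict Implicit.
Unset Printing Implicit Defensive.

Import Order.TTheory GRing.Theory Num.Theory.

(** * The graph distance *)

Section Distance.
Variables (V : finType) (e : rel V).
Hypothesis graph_e : is_graph e.
Local Notation d := (gdist e).

Lemma gdistxx x : d x x = 0.
Proof. by apply/eqP; rewrite -leqn0 (@gdist_le _ e x [::]). Qed.

Lemma gdist_triangle y x z : d x z <= d x y + d y z.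
Proof.
have [_ _ con _] := graph_e.
have [p [ep lp <-]] := gdist_geodesic (con x y).
have [q [eq lq <-]] := gdist_geodesic (con y z).
rewrite -size_cat -lq -[y]lp -last_cat; apply: gdist_le.
by rewrite cat_path ep lp eq.
Qed.

Lemma gdist_eq0 x y : (d x y == 0) = (x == y).
Proof.
have [_ _ con _] := graph_e.
apply/eqP/eqP => [d0|->]; last exact: gdistxx.
have [p [_ lp sp]] := gdist_geodesic (con x y).
by move: sp lp; rewrite d0; case: p.
Qed.

Lemma gdistC x y : d x y = d y x.
Proof.
have [sym _ con _] := graph_e.
suff H a b : d a b <= d b a by apply/eqP; rewrite eqn_leq !H.
move: a b => {}x {}y.
have [p [ep lp <-]] := gdist_geodesic (con y x).
have := rev_path e y p; rewrite lp => r.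
have er : path e x (rev (belast y p)).
  by rewrite r; apply: sub_path ep => a b /=; rewrite sym.
have := gdist_le er; rewrite size_rev size_belast.
by case: p lp {ep r er} => [|a p] /= lp; rewrite ?lp // rev_cons last_rcons.
Qed.

Lemma gdist_step x y n : d x y = n.+1 -> exists2 z, e x z & d z y = n.
Proof.
have [_ _ con _] := graph_e => dxy.
have [[|z p] [ep lp]] := gdist_geodesic (con x y); rewrite dxy // => -[sp].
move: ep lp => /= /andP[xz ep] lp; exists z => //.
have le1 := gdist_le ep; rewrite lp sp in le1.
have xz1 : d x z <= 1 by apply: (@gdist_le _ e x [:: z]); rewrite /= xz.
by have := gdist_triangle z x y; lia.
Qed.

Lemma gdist1 x y : (d x y == 1) = e x y.
Proof.
have [_ irr _ _] := graph_e.
apply/eqP/idP => [/gdist_step [z xz /eqP]|xy].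
  by rewrite gdist_eq0 => /eqP <-.
apply/eqP; rewrite eqn_leq (@gdist_le _ e x [:: y]) /= ?xy // lt0n gdist_eq0.
by apply: contraTneq xy => ->; rewrite irr.
Qed.

Lemma gdist_edge x y : e x y -> d x y = 1.
Proof. by rewrite -gdist1 => /eqP. Qed.

Lemma gdist_edge_le u x y : e x y -> d u x <= (d u y).+1.
Proof.
by move=> /gdist_edge; rewrite gdistC; have := gdist_triangle y u x; lia.
Qed.

Lemma gdist_diam x y : d x y <= diam e.
Proof. by apply: leq_trans (leq_bigmax x); exact: (leq_bigmax y). Qed.

Lemma diam_gt0 : 0 < diam e.
Proof.
have [_ _ _ [x [y xy]]] := graph_e.
by have := gdist_diam x y; rewrite gdist_edge.
Qed.

(** Summation along a geodesic: on edges that lead away from [x] a bound on the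
    increment of [F] adds up. *)
Lemma geodesic_propagation (K : numDomainType) (F : V -> K) (a : K) x :
  (forall p q, e p q -> d x q = (d x p).+1 -> F q - F p <= a)%R ->
  forall p q, (d x p + d p q = d x q)%N -> (F q - F p <= a *+ d p q)%R.
Proof.
move=> Fe p q; move: {2}(d p q) (erefl (d p q)) => n.
elim: n p => [|n IH] p dpq xpq.
  by move/eqP: (dpq); rewrite gdist_eq0 => /eqP ->; rewrite gdistxx subrr.
have [z pz zq] := gdist_step dpq.
have xz : d x z = (d x p).+1.
  have := gdist_triangle z x q; have := gdist_triangle p x z.
  by rewrite (gdist_edge pz); lia.
rewrite -(subrKA (F z)) dpq mulrSr -zq; apply: lerD; last exact: Fe.
by apply: IH => //; lia.
Qed.

End Distance.

(** The neighbours of [p] outside the ball around [q] are sent to neighbours of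
    [q] in such a way that whenever [d u] increases or decreases along [p q], it
    does the same along the edge from a vertex to its target. *)
Definition matched_edges (V : finType) (e : rel V) : Prop :=
  forall p q w, e p q -> e p w -> gdist e w q = 2 ->
  exists v, [/\ e q v, e w v, gdist e p v = 2,
    forall u, gdist e u q = (gdist e u p).+1 -> gdist e u v = (gdist e u w).+1 &
    forall u, gdist e u p = (gdist e u q).+1 -> gdist e u w = (gdist e u v).+1].

(** * Transport between balls of radius 1 *)

Section Transport.
Variables (R : realType) (V : finType) (e : rel V) (D : nat).
Hypothesis graph_e : is_graph e.
Hypothesis reg : regular e D.
Local Notation d := (gdist e).
Local Open Scope ring_scope.

(** Integer-valued potentials suffice below; for them a nonzero slack in the
    Lipschitz condition is at least 1. *)
Definition ball_sum (f : V -> int) (x : V) : R :=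
  \sum_(v | (v == x) || e x v) (f v)%:~R.

Definition transport_cost (pi : V -> V -> R) : R :=
  \sum_u \sum_v (d u v)%:R * pi u v.

Definition lipschitz (f : V -> int) : Prop :=
  forall u v, f v - f u <= (d u v)%:Z.

Lemma gdist_lipschitz u : lipschitz (fun v => (d u v)%:Z).
Proof. by move=> v w; have := gdist_triangle graph_e v u w; lia. Qed.

Lemma gdistN_lipschitz u : lipschitz (fun v => - (d u v)%:Z).
Proof.
move=> v w; have := gdist_triangle graph_e w u v.
by rewrite (gdistC graph_e w v); lia.
Qed.

Lemma ball_sumE f x :
  ball_sum f x = (f x)%:~R + \sum_(v in [set y | e x y]) (f v)%:~R.
Proof.
have [_ irr _ _] := graph_e.
rewrite /ball_sum (bigD1 x) ?eqxx //=; congr (_ + _).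
apply: eq_bigl => v; rewrite inE andb_orl andbN /=.
by case: eqVneq => [->|]; rewrite ?irr ?andbT.
Qed.

Lemma ball_sum_cst (m : int) x : ball_sum (fun=> m) x = D.+1%:R * m%:~R.
Proof.
by rewrite ball_sumE sumr_const reg -mulrS mulr_natl.
Qed.

Lemma integral_ball_measure f x :
  \sum_u (f u)%:~R * ball_measure R e D x u = D.+1%:R^-1 * ball_sum f x.
Proof.
rewrite /ball_sum [in RHS]big_mkcond mulr_sumr; apply: eq_bigr => u _.
by rewrite /ball_measure; case: ifP => _; rewrite ?mulr0 // mulrC.
Qed.

Lemma ball_measure_ge0 x u : 0 <= ball_measure R e D x u.
Proof. by rewrite /ball_measure; case: ifP => //; rewrite invr_ge0 ler0n. Qed.

Lemma sum_ball_measure x : \sum_u ball_measure R e D x u = 1.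
Proof.
have := integral_ball_measure (fun=> 1) x; rewrite ball_sum_cst mulr1.
rewrite mulVf ?pnatr_eq0 // => <-.
by apply: eq_bigr => u _; rewrite mul1r.
Qed.

(** The duality gap of a potential, written as the average of its pointwise
    slack. *)
Lemma transport_slack pi p q f :
  coupling (ball_measure R e D p) (ball_measure R e D q) pi ->
  \sum_u \sum_v ((d u v)%:Z - (f v - f u))%:~R * pi u v
  = transport_cost pi - D.+1%:R^-1 * (ball_sum f q - ball_sum f p).
Proof.
case=> _ mup muq; rewrite mulrBr -!integral_ball_measure.
have -> : \sum_u (f u)%:~R * ball_measure R e D q u
          = \sum_u \sum_v (f v)%:~R * pi u v.
  rewrite exchange_big; apply: eq_bigr => v _ /=.
  by rewrite -muq mulr_sumr.
rewrite -sumrB -sumrB; apply: eq_bigr => u _.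
rewrite -mup mulr_sumr -sumrB -sumrB; apply: eq_bigr => v _.
by rewrite -mulrBl -mulrBl !intrB.
Qed.

Lemma has_coupling p q :
  exists pi, coupling (ball_measure R e D p) (ball_measure R e D q) pi.
Proof.
have le1 x u : ball_measure R e D x u <= 1.
  rewrite -(sum_ball_measure x) (bigD1 u) //= lerDl.
  by apply: sumr_ge0 => v _; exact: ball_measure_ge0.
exists (fun u v => ball_measure R e D p u * ball_measure R e D q v).
split=> [u v|u|v]; last 2 first.
- by rewrite -mulr_sumr sum_ball_measure mulr1.
- by rewrite -mulr_suml sum_ball_measure mul1r.
by rewrite mulr_ge0 ?mulr_ile1 ?ball_measure_ge0.
Qed.

Lemma near_optimal_coupling p q eps : 0 < eps ->
  exists2 pi, coupling (ball_measure R e D p) (ball_measure R e D q) pi &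
    transport_cost pi
      < W1 e (ball_measure R e D p) (ball_measure R e D q) + eps.
Proof.
move=> eps0; have [pi0 cpi0] := has_coupling p q.
have [|_ [pi cpi <-] ?] := @inf_adherent R
  [set transport_cost pi
     | pi in [set pi | coupling (ball_measure R e D p)
                                (ball_measure R e D q) pi]]%classic _ eps0.
- split; first by exists (transport_cost pi0), pi0.
  exists 0 => _ [pi [pi01 _ _] <-].
  apply: sumr_ge0 => u _; apply: sumr_ge0 => v _.
  by rewrite mulr_ge0 ?ler0n //; have /andP[] := pi01 u v.
- by exists pi.
Qed.

(** Weak Kantorovich duality. *)
Lemma ball_sum_le_W1 p q f : lipschitz f ->
  ball_sum f q - ball_sum f p
  <= D.+1%:R * W1 e (ball_measure R e D p) (ball_measure R e D q).
Proof.
move=> lip; rewrite -ler_pdivrMl ?ltr0n //.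
apply/ler_addgt0Pr => eps eps0.
have [pi cpi /ltW lepi] := near_optimal_coupling p q eps0.
apply: le_trans lepi; rewrite -subr_ge0 -transport_slack //.
have [pi01 _ _] := cpi.
apply: sumr_ge0 => u _; apply: sumr_ge0 => v _.
have /andP[pi0 _] := pi01 u v.
by rewrite mulr_ge0 // ler0z subr_ge0.
Qed.

(** Complementary slackness, without an optimal coupling: a coupling whose cost
    is close enough to the infimum has to carry a fixed part of the mass at [w]
    to a single [v], and a potential with integral positive slack at [(w, v)]
    would then have too large a duality gap. The point is that one [v] serves all
    optimal potentials simultaneously. *)
Lemma common_transport_target p q w : (w == p) || e p w ->
  exists2 v, (v == q) || e q v &
    forall f, lipschitz f ->
      ball_sum f q - ball_sum f p
        = D.+1%:R * W1 e (ball_measure R e D p) (ball_measure R e D q) ->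
      f v - f w = (d w v)%:Z.
Proof.
move=> wp; have V0 : (0 < #|V|)%N by apply/card_gt0P; exists w.
(* By pigeonhole, [eps] is a mass that some target of [w] always receives. *)
pose eps : R := (D.+1%:R * #|V|%:R)^-1.
have eps0 : 0 < eps by rewrite invr_gt0 mulr_gt0 ?ltr0n.
have [pi cpi ltpi] := near_optimal_coupling p q eps0.
have [pi01 mup muq] := cpi.
have pi0 u v : 0 <= pi u v by have /andP[] := pi01 u v.
have [v piv] : exists v, eps <= pi w v.
  apply/existsP; apply: contraT => /existsPn small.
  have : \sum_v pi w v < \sum_(v : V) eps.
    apply: ltr_sum => [|v _]; last by rewrite ltNge small.
    by apply/hasP; exists w; rewrite ?mem_index_enum.
  rewrite mup /ball_measure wp sumr_const /eps invfM -[ltRHS]mulr_natr.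
  by rewrite -mulrA mulVf ?mulr1 ?ltxx // pnatr_eq0 -lt0n.
exists v => [|f lip tight].
  apply: contraT => qv; have := muq v; rewrite /ball_measure (negbTE qv).
  rewrite (bigD1 w) //= => s0.
  have : 0 <= \sum_(i | i != w) pi i v by apply: sumr_ge0.
  lra.
apply/eqP; rewrite eq_le lip /= leNgt; apply/negP => slack.
have := transport_slack f cpi.
rewrite tight mulKf ?pnatr_eq0 // => sE.
have : eps <= \sum_u \sum_v ((d u v)%:Z - (f v - f u))%:~R * pi u v.
  have s0 u z : 0 <= ((d u z)%:Z - (f z - f u))%:~R * pi u z.
    by rewrite mulr_ge0 // ler0z subr_ge0.
  rewrite (bigD1 w) //= (bigD1 v) //= -addrA.
  apply: ler_wpDr.
    by rewrite addr_ge0 ?sumr_ge0 // => u _; apply: sumr_ge0.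
  apply: le_trans piv _; rewrite -[leLHS]mul1r ler_wpM2r //.
  by rewrite ler1z; lia.
by rewrite sE; lra.
Qed.

End Transport.

(** * Bonnet-Myers sharp graphs *)

Section Sharp.
Variables (R : realType) (V : finType) (e : rel V).
Hypothesis graph_e : is_graph e.
Local Notation d := (gdist e).
Local Open Scope ring_scope.

(** The value of [(D + 1) W1] on an edge of curvature [2 / L]. *)
Definition edge_cost (D : nat) : R :=
  D.+1%:R - 2 * D%:R / (diam e)%:R.

Lemma edge_cost_diam D :
  edge_cost D *+ diam e = D.+1%:R * (diam e)%:R - 2 * D%:R.
Proof.
have L0 : (diam e)%:R != 0 :> R by rewrite pnatr_eq0 -lt0n diam_gt0.
by rewrite /edge_cost -[LHS]mulr_natr mulrBl mulfVK.
Qed.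

Lemma sharp_W1_le : Bonnet_Myers_sharp R e ->
  exists2 D, regular e D & forall p q, e p q ->
    D.+1%:R * W1 e (ball_measure R e D p) (ball_measure R e D q) <= edge_cost D.
Proof.
case=> D reg infE; exists D => // p q pq.
have D0 : (0 < D)%N by rewrite -(reg p); apply/card_gt0P; exists q; rewrite inE.
have : 2 / (diam e)%:R <= kappa R e D p q.
  rewrite -infE; apply: ge_inf; last by exists p, q.
  exists (- \sum_x \sum_y `|kappa R e D x y|) => _ [x [y [_ ->]]].
  rewrite lerNl; apply: le_trans (ler_norm _) _; rewrite normrN.
  rewrite (bigD1 x) //= (bigD1 y) //= -addrA lerDl addr_ge0 ?sumr_ge0 // => ? _.
  exact: sumr_ge0.
rewrite /kappa gdist_edge // divr1.
set W := W1 _ _ _; rewrite -(ler_pM2l (_ : 0 < D%:R)) ?ltr0n //.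
have Dn0 : D%:R != 0 :> R by rewrite pnatr_eq0 -lt0n.
have -> : D%:R * (D.+1%:R / D%:R * (1 - W)) = D.+1%:R - D.+1%:R * W.
  by field.
rewrite /edge_cost mulrCA mulrA; lra.
Qed.

Variable D : nat.
Hypothesis reg : regular e D.
Hypothesis edge_W1 : forall p q, e p q ->
  D.+1%:R * W1 e (ball_measure R e D p) (ball_measure R e D q) <= edge_cost D.

Local Notation dist_sum u := (ball_sum R e (fun v => (d u v)%:Z)).

Lemma dist_sum_center u : dist_sum u u = D%:R.
Proof.
rewrite ball_sumE // gdistxx add0r -(reg u) -sum1_card natr_sum.
by apply: eq_bigr => v; rewrite inE => /gdist_edge ->.
Qed.

Lemma dist_sum_growth u p q : (d u p + d p q = d u q)%N ->
  dist_sum u q - dist_sum u p <= edge_cost D *+ d p q.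
Proof.
apply: (geodesic_propagation graph_e) => {}p {}q pq _.
apply: le_trans (edge_W1 pq); apply: ball_sum_le_W1 => //.
exact: gdist_lipschitz.
Qed.

Lemma dist_sum_le u z : dist_sum u z <= D%:R + edge_cost D *+ d u z.
Proof.
rewrite -lerBlDl -[X in _ - X](dist_sum_center u).
by apply: dist_sum_growth; rewrite gdistxx.
Qed.

(** A minimum principle: [d x + d y] is at least [L] everywhere, and where it
    equals [L] its mean over the ball is at most [L]; so the value [L] spreads
    from [x] to all vertices. *)
Lemma diametral_interval x y : d x y = diam e ->
  forall z, (d x z + d z y)%N = diam e.
Proof.
move=> xy z; have [n] := ubnP (d z x); elim: n z => // n IH z.
case zx: (d z x) => [|m]; last rewrite ltnS => mn.
  by move/eqP: zx; rewrite gdist_eq0 // => /eqP -> _; rewrite gdistxx.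
have [w zw wx] := gdist_step graph_e zx.
have gw : (d x w + d w y)%N = diam e by apply: IH; rewrite wx.
pose g v := (d x v + d y v - diam e)%N.
have ge v : (diam e <= d x v + d y v)%N.
  by rewrite -xy (gdistC graph_e y) gdist_triangle.
have sum0 : \sum_(v | (v == w) || e w v) (g v)%:R <= 0 :> R.
  have -> : \sum_(v | (v == w) || e w v) (g v)%:R
          = dist_sum x w + dist_sum y w - D.+1%:R * (diam e)%:R.
    rewrite -[(diam e)%:R]/((diam e)%:Z%:~R) -(ball_sum_cst R graph_e reg _ w).
    rewrite -big_split -sumrB; apply: eq_bigr => v _ /=.
    by rewrite natrB // natrD.
  have := lerD (dist_sum_le x w) (dist_sum_le y w).
  have := edge_cost_diam D; rewrite -gw (gdistC graph_e w y) mulrnDr natrD; lra.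
have : (g z)%:R <= 0 :> R.
  apply: le_trans sum0.
  rewrite (bigD1 z) /=; last first.
    by have [sym _ _ _] := graph_e; rewrite sym zw orbT.
  by rewrite lerDl sumr_ge0 // => v _; rewrite ler0n.
rewrite lern0 subn_eq0 (gdistC graph_e z y).
by have := ge z; lia.
Qed.

Hypothesis self_centered_e : self_centered e.

(** The edge [p q] lies on a geodesic from [u] to its antipode [y]. Along this
    geodesic [dist_sum u] can grow by at most [L] times [edge_cost D], and it has
    to, because [dist_sum u y] is at least [(D + 1) L - D]. *)
Lemma dist_sum_edge u p q : e p q -> d u q = (d u p).+1 ->
  dist_sum u q - dist_sum u p = edge_cost D.
Proof.
move=> pq uq; apply/eqP; rewrite eq_le; apply/andP; split.
  rewrite -[leRHS]mulr1n -(gdist_edge graph_e pq).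
  by apply: dist_sum_growth; rewrite uq (gdist_edge graph_e pq) addn1.
have [y uy] := self_centered_e u.
have uqy := diametral_interval uy q.
have up := dist_sum_le u p.
have yq : dist_sum u y - dist_sum u q <= edge_cost D *+ d q y.
  by apply: dist_sum_growth; rewrite uqy.
have far : D.+1%:R * (diam e)%:R - D%:R <= dist_sum u y.
  have -> : D.+1%:R * (diam e)%:R - D%:R
      = (diam e)%:R + \sum_(v in [set v | e y v]) ((diam e)%:R - 1) :> R.
    by rewrite sumr_const reg -mulr_natl -natr1; ring.
  rewrite ball_sumE // uy lerD2l; apply: ler_sum => v; rewrite inE => yv.
  have := gdist_edge_le graph_e u yv; rewrite uy lerBlDr => le.
  by rewrite natr1 ler_nat.
have cL : edge_cost D *+ diam e
    = edge_cost D *+ d u p + edge_cost D + edge_cost D *+ d q y.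
  by rewrite -uqy uq mulrnDr mulrSr.
have := edge_cost_diam D; rewrite cL; lra.
Qed.

Lemma W1_edge p q : e p q ->
  D.+1%:R * W1 e (ball_measure R e D p) (ball_measure R e D q) = edge_cost D.
Proof.
move=> pq; apply/eqP; rewrite eq_le edge_W1 //=.
rewrite -(@dist_sum_edge p p q) //; last by rewrite gdistxx // gdist_edge.
by apply: ball_sum_le_W1 => //; exact: gdist_lipschitz.
Qed.

(** The potentials [d u] and [- d u] are optimal for the transport from [p] to [q]
    according to the direction in which [d u] changes along [p q]. Taking
    [u = p], their common target [v] is at distance 1 from [w] and 2 from [p]. *)
Lemma edge_matching : matched_edges e.
Proof.
move=> p q w pq pw wq.
have pwb : (w == p) || e p w by rewrite pw orbT.
have [v qv tight] := common_transport_target R graph_e reg q pwb.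
have up u : d u q = (d u p).+1 -> d u v = (d u w + d w v)%N.
  move=> uq; have := tight _ (gdist_lipschitz graph_e u).
  by rewrite W1_edge // dist_sum_edge // => /(_ erefl); lia.
have dn u : d u p = (d u q).+1 -> d u w = (d u v + d w v)%N.
  move=> uq; have := tight _ (gdistN_lipschitz graph_e u).
  have opp z : ball_sum R e (fun v => - (d u v)%:Z) z = - dist_sum u z.
    by rewrite /ball_sum -sumrN; apply: eq_bigr => t _; rewrite intrN.
  rewrite W1_edge // !opp opprK [- _ + _]addrC.
  have [sym _ _ _] := graph_e.
  by rewrite -(@dist_sum_edge u q p) // 1?sym // => /(_ erefl); lia.
have d1 := gdist_edge graph_e.
have pv : d p v = (1 + d w v)%N.
  by rewrite (up p) ?(d1 _ _ pw) // (d1 _ _ pq) gdistxx.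
have qv1 : (d q v <= 1)%N by case/orP: qv => [/eqP->|/d1->//]; rewrite gdistxx.
have vw0 : (0 < d w v)%N.
  rewrite lt0n gdist_eq0 //; apply: contraTneq qv1 => <-.
  by rewrite gdistC // wq.
have tri : (d p v <= 1 + d q v)%N by rewrite -(d1 _ _ pq) gdist_triangle.
have wv1 : d w v = 1%N by lia.
exists v; split; last 2 first.
- by move=> u /up ->; rewrite wv1 addn1.
- by move=> u /dn ->; rewrite wv1 addn1.
- by rewrite -gdist1 //; apply/eqP; lia.
- by rewrite -gdist1 // wv1.
- by rewrite pv wv1.
Qed.

End Sharp.

(** * Four-cycles and parallel pairs *)

Section Intervals.
Variables (V : finType) (e : rel V).
Hypothesis graph_e : is_graph e.
Local Notation d := (gdist e).

Hypothesis matching : matched_edges e.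

(** In an induced 4-cycle the target of [w] can only be [v]: seen from [v], the
    distance decreases from [p] to [q], hence from [w], where it is 1, to the
    target. *)
Lemma four_cycle_monotone p q w v : e p q -> e p w -> e q v -> e w v ->
  d p v = 2 -> d w q = 2 -> forall u,
  (d u q = (d u p).+1 -> d u v = (d u w).+1) /\
  (d u p = (d u q).+1 -> d u w = (d u v).+1).
Proof.
move=> pq pw qv wv pv wq.
have [v' [_ _ _ up dn]] := matching pq pw wq.
suff -> : v = v' by move=> u; split; [exact: up | exact: dn].
have vp : d v p = (d v q).+1.
  by rewrite gdistC // pv (gdistC graph_e v q) gdist_edge.
have := dn v vp; rewrite gdistC // gdist_edge // => -[/esym/eqP].
by rewrite gdist_eq0 // => /eqP.
Qed.

(** By symmetry of the 4-cycle, [d u] increases along [p q] exactly if it does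
    along [w v], and likewise for decreasing; so the two increments agree. *)
Lemma four_cycle_balance p q w v : e p q -> e p w -> e q v -> e w v ->
  d p v = 2 -> d w q = 2 -> forall u, d u v + d u p = d u w + d u q.
Proof.
move=> pq pw qv wv pv wq u.
have [sym _ _ _] := graph_e.
have [up1 dn1] := four_cycle_monotone pq pw qv wv pv wq u.
have [] := @four_cycle_monotone w v p q wv _ _ pq wq pv u; rewrite 1?sym //.
have := gdist_edge_le graph_e u pq; have := gdist_edge_le graph_e u wv.
have := @gdist_edge_le _ _ graph_e u q p.
have := @gdist_edge_le _ _ graph_e u v w.
rewrite !(sym q p) !(sym v w) pq wv => /(_ isT) ? /(_ isT) ?.
lia.
Qed.

(** In a hypercube this says that [z] and [t] arise from [x] and [y] by exchanging
    some coordinates. *)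
Definition parallel_pairs x y z t : Prop :=
  forall u, d z u + d t u = d x u + d y u.

Lemma parallel_pairs_dist x y z t : parallel_pairs x y z t -> d z t = d x y.
Proof.
move=> par; have := par z; have := par t; have := par x; have := par y.
rewrite !gdistxx // !(gdistC graph_e z) !(gdistC graph_e t).
rewrite (gdistC graph_e y x); lia.
Qed.

(** Move along a geodesic from [z] to [y] and slide the edge [x z] across one
    induced 4-cycle after the other; the partner of the last vertex is [t]. *)
Lemma parallel_pair_step x y z : e x z -> d x y = (d z y).+1 ->
  exists t, parallel_pairs x y z t.
Proof.
move=> xz; have [n] := ubnP (d z y); elim: n y => // n IH y.
case zy: (d z y) => [|m] ltmn xy.
  exists x => u; move/eqP: zy; rewrite gdist_eq0 // => /eqP ->.
  by rewrite addnC.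
have [sym _ _ _] := graph_e.
have [y0 yy0 zy0] := gdist_step graph_e (etrans (gdistC graph_e y z) zy).
rewrite gdistC // in zy0.
have y0y : e y0 y by rewrite sym.
have xy0 : d x y0 = (d z y0).+1.
  have := gdist_triangle graph_e z x y0; rewrite (gdist_edge graph_e xz).
  by have := gdist_edge_le graph_e x yy0; lia.
have [|w par] := IH y0 _ xy0; first lia.
have wy0 : d w y0 = 1 by have := par y0; rewrite (gdistxx e y0); lia.
have y0w : e y0 w by rewrite sym -gdist1 // wy0.
have wy : d w y = 2.
  by have := par y; rewrite (gdist_edge graph_e y0y); lia.
have [t [yt wt y0t _ _]] := matching y0y y0w wy.
exists t => u; have := par u.
have := four_cycle_balance y0y y0w yt wt y0t wy u.
rewrite !(gdistC graph_e u); lia.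
Qed.

(** Walk along a geodesic from [x] to [z], replacing the pair by a parallel pair
    at each step. *)
Lemma parallel_pair x y z : z \in ginterval e x y ->
  exists t, parallel_pairs x y z t.
Proof.
have [n] := ubnP (d x z); elim: n x y => // n IH x y.
case xz: (d x z) => [|m] ltmn; rewrite inE => /eqP zI.
  by move/eqP: xz; rewrite gdist_eq0 // => /eqP <-; exists y.
have [x' xx' x'z] := gdist_step graph_e xz.
have xy : d x y = (d x' y).+1.
  have := gdist_triangle graph_e z x' y; have := gdist_triangle graph_e x' x y.
  by rewrite (gdist_edge graph_e xx'); lia.
have [y' par] := parallel_pair_step xx' xy.
have zI' : z \in ginterval e x' y'.
  rewrite inE (parallel_pairs_dist par); have := par z.
  by rewrite (gdistC graph_e z y') (gdistC graph_e y z); lia.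
have [|t par'] := IH x' y' _ zI'; first lia.
by exists t => u; rewrite par'.
Qed.

End Intervals.

(** * Distances in intervals *)

Section Induced.
Variables (V : finType) (e : rel V).
Hypothesis graph_e : is_graph e.
Local Notation d := (gdist e).

Lemma gdist_induced (A : {set V}) (s u : {x : V | x \in A}) :
  is_graph (induced e (A := A)) -> ginterval e (val s) (val u) \subset A ->
  gdist (induced e (A := A)) s u = d (val s) (val u).
Proof.
move=> graphH sub; apply/eqP; rewrite eqn_leq; apply/andP; split; last first.
  have [_ _ conH _] := graphH.
  have [p [Hp <- <-]] := gdist_geodesic (conH s u).
  rewrite -(last_map val) -(size_map val); apply: gdist_le.
  by apply: homo_path Hp => a b.
move: {2}(d _ _) (erefl (d (val s) (val u))) => n.
elim: n s sub => [|n IH] s sub su.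
  by move/eqP: su; rewrite gdist_eq0 // => /eqP/val_inj ->; rewrite gdistxx.
have [z sz zu] := gdist_step graph_e su.
have near w : d z w + d w (val u) = n -> w \in A.
  move=> zwu; apply: (fintype.subsetP sub).
  rewrite inE eqn_leq gdist_triangle // andbT.
  have := gdist_triangle graph_e z (val s) w.
  rewrite (gdist_edge graph_e sz) su; lia.
have zA : z \in A by apply: near; rewrite gdistxx.
have le_zu := IH (exist _ z zA) _ zu.
apply: leq_trans (gdist_triangle graphH (exist _ z zA) s u) _.
rewrite (gdist_edge graphH) // su -zu add1n ltnS; apply: le_zu.
by apply/fintype.subsetP => w; rewrite inE zu => /eqP /near.
Qed.

(** A parallel pair [z], [t] spans the same interval as [x], [y]. For [u] in this
    interval the geodesics from [z] to [u] and from [u] to [t] stay inside, so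
    the distances involved do not change in the induced subgraph. *)
Lemma antipodal_interval x y : x != y ->
  (forall z, z \in ginterval e x y -> exists t, parallel_pairs e x y z t) ->
  antipodal (induced e (A := ginterval e x y)).
Proof.
move=> xy par [z zI]; have [t zt] := par z zI.
have graphH := induced_interval_graph graph_e xy.
have dzt := parallel_pairs_dist graph_e zt.
have intE u : (u \in ginterval e x y) = (d z u + d u t == d z t).
  rewrite inE dzt (gdistC graph_e u t) zt.
  by rewrite (gdistC graph_e u y).
have tI : t \in ginterval e x y by rewrite intE gdistxx addn0.
have sub a b : d z a + d a b + d b t = d z t ->
    ginterval e a b \subset ginterval e x y.
  move=> zabt; apply/fintype.subsetP => w; rewrite inE intE => /eqP awb.
  have := gdist_triangle graph_e a z w; have := gdist_triangle graph_e b w t.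
  by have := gdist_triangle graph_e w z t; lia.
exists (exist _ t tI).
  apply: contra_neq xy => -[tz]; apply/eqP.
  by rewrite -(gdist_eq0 graph_e) -dzt tz gdistxx.
apply/setP => -[u uI]; have /eqP zut : d z u + d u t == d z t by rewrite -intE.
rewrite !inE !gdist_induced //=; first by rewrite zut eqxx.
all: by apply: sub; rewrite !gdistxx; lia.
Qed.

End Induced.

Theorem theorem8p8 (R : realType) (V : finType) (e : rel V) :
  is_graph e ->
  self_centered e ->
  Bonnet_Myers_sharp R e ->
  (forall x y : V, x != y ->
     antipodal (induced e (A := ginterval e x y))) /\
  strongly_spherical e.
Proof.
move=> graph_e sc_e /(sharp_W1_le graph_e) [D reg edge_W1].
have intervals x y : x != y -> antipodal (induced e (A := ginterval e x y)).
  move=> xy; apply: antipodal_interval => // z.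
  apply: parallel_pair => //.
  exact: (edge_matching graph_e reg edge_W1 sc_e).
split=> //; split=> // x; have [y xy] := sc_e x; exists y.
  by rewrite -(gdist_eq0 graph_e) gdistC // xy -lt0n diam_gt0.
apply/setP => z; rewrite !inE xy.
by rewrite (diametral_interval graph_e reg edge_W1 xy) eqxx.
Qed.
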